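(* Let $(X,\mu)$ be a measure space, let $\{H(x):x\in X\}$ be a $\mu$-measurable collection of Hilbert spaces over $\mathbb{F}$ ($\mathbb{F}=\mathbb{R}$ or $\mathbb{F}=\mathbb{C}$), and let $\Phi=(\varphi_n)_{n=1}^{\infty}$ be an arbitrary orthonormal system in the direct integral $\mathbf{L}_2=\int_X^{\oplus}H(x)\,d\mu(x)$. Let $a=(a_n)_{n=1}^{\infty}$ be a sequence of numbers in $\mathbb{F}$ such that $$L:=\sum_{n=1}^{\infty}|a_n|^2\,\log_2^2(n+1)<\infty .$$ Then the series $\sum_{n=1}^{\infty}a_n\varphi_n(x)$ converges (in the norm of $H(x)$) for $\mu$-almost every $x\in X$, and moreover the majorant of partial sums $$S^{*}(\Phi,a,x):=\sup_{m\in\mathbb{N}}\Bigl\|\sum_{n=1}^{m}a_n\varphi_n(x)\Bigr\|_{H(x)},\quad x\in X,$$ satisfies $$\|S^{*}(\Phi,a,\cdot)\|_{2}\le K\sqrt{L},$$ where $K$ is a certain universal positive constant (independent of $X$, $\mu$, $\{H(x)\}$, $\Phi$ and $a$); one may take $K=4$.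
   Context: $X$ is an arbitrary measurable space with a $\sigma$-additive measure $\mu\ge 0$, not assumed finite or $\sigma$-finite. $\{H(x):x\in X\}$ is a collection of Hilbert spaces, either all real or all complex, of arbitrary dimensions; it is called $\mu$-measurable if the function $x\mapsto\dim H(x)$ takes only finitely or countably many values (cardinal numbers) and all the sets $\{x\in X:\dim H(x)=\mathrm{const}\}$ are $\mu$-measurable. The direct integral $\mathbf{L}_2=\int_X^{\oplus}H(x)\,d\mu(x)$ is the Hilbert space with inner product $(f,g)_2=\int_X(f(x),g(x))_{H(x)}\,d\mu(x)$ and norm $\|\cdot\|_2$. In the standard way: on each set $X_\kappa=\{x:\dim H(x)=\kappa\}$ the spaces $H(x)$ are identified with one fixed Hilbert space $H_\kappa$ of dimension $\kappa$, and $\mathbf{L}_2$ consists of the classes of $\mu$-equivalent functions $f$ on $X$ with $f(x)\in H(x)$, whose restriction to each $X_\kappa$ is a strongly $\mu$-measurable $H_\kappa$-valued function, and with $\|f\|_2^2=\int_X\|f(x)\|_{H(x)}^2\,d\mu(x)<\infty$. In particular, if $H(x)\equiv H$ is constant, then $\mathbf{L}_2=L_2(X,d\mu;H)$, the space of classes of strongly $\mu$-measurable square-integrable functions $f:X\to H$. For a nonnegative measurable scalar function $S$ on $X$, $\|S\|_2=\bigl(\int_X S(x)^2\,d\mu(x)\bigr)^{1/2}$. Notation: $\log_2^2 t=(\log_2 t)^2$, and $\mathbb{N}$ is the set of positive integers. *)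

(* Defs.v *)
From HB Require Import structures.
From mathcomp Require Import all_boot all_order all_algebra.
From mathcomp Require Import complex.
From mathcomp Require Import all_classical all_reals all_analysis.
From mathcomp Require Import measurable_realfun.

Set Implicit Arguments.
Unset Strict Implicit.
Unset Printing Implicit Defensive.

Import Order.TTheory GRing.Theory Num.Theory.
Import numFieldNormedType.Exports.

Local Open Scope classical_set_scope.
Local Open Scope ring_scope.

(* Real and complex Hilbert spaces are treated together; [sfield R k] is the
   field of scalars, R or R[i]. *)
Variant scalar_kind := RealScalars | ComplexScalars.

Definition sfield (R : realType) (k : scalar_kind) : numFieldType :=
  match k with
  | RealScalars => R
  | ComplexScalars => R[i]
  end.

Definition sconj (R : realType) (k : scalar_kind) : sfield R k -> sfield R k :=
  match k return sfield R k -> sfield R k with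
  | RealScalars => fun z : R => z
  | ComplexScalars => fun z : R[i] => Num.conj z
  end.

(* In MathComp the norm of a normed module over K takes its values in K, as
   nonnegative elements; [sre] brings such elements back to R. *)
Definition sre (R : realType) (k : scalar_kind) : sfield R k -> R :=
  match k return sfield R k -> R with
  | RealScalars => fun z : R => z
  | ComplexScalars => fun z : R[i] => complex.Re z
  end.

Definition scalar_integral (R : realType) (k : scalar_kind)
    (d : measure_display) (X : measurableType d)
    (mu : {measure set X -> \bar R}) : (X -> sfield R k) -> sfield R k :=
  match k return (X -> sfield R k) -> sfield R k with
  | RealScalars => fun h : X -> R => Rintegral mu setT h
  | ComplexScalars => fun h : X -> R[i] =>
      (Rintegral mu setT (fun x => complex.Re (h x)) +i*
       Rintegral mu setT (fun x => complex.Im (h x)))%C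
  end.

(* The inner product is linear in its first argument. *)
Record hilbertType (R : realType) (k : scalar_kind) := HilbertType {
  hilbert_carrier :> completeNormedModType (sfield R k);
  inner : {dot hilbert_carrier for @sconj R k};
  inner_normE : forall v : hilbert_carrier, inner v v = `|v| ^+ 2
}.
Arguments inner {R k} h.

Section HilbertSpaces.
Variables (R : realType) (k : scalar_kind).
Implicit Types H : hilbertType R k.

Definition hnorm H (v : H) : R := sre `|v|.

Definition orthonormal_basis H (B : set H) : Prop :=
  (forall u v, B u -> B v -> inner H u v = (u == v)%:R) /\
  (forall w, (forall u, B u -> inner H w u = 0) -> w = 0).

(* Equality of Hilbert dimensions, as cardinal numbers. *)
Definition same_dim H1 H2 : Prop :=
  exists (B1 : set H1) (B2 : set H2),
    [/\ orthonormal_basis B1, orthonormal_basis B2 & (B1 #= B2)%card].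

Definition unitary H1 H2 (U : {linear H1 -> H2}) : Prop :=
  bijective U /\ forall u v, inner H2 (U u) (U v) = inner H1 u v.

End HilbertSpaces.

Section DirectIntegral.
Variables (R : realType) (k : scalar_kind).
Variables (d : measure_display) (X : measurableType d).
Variable mu : {measure set X -> \bar R}.

(* [C] contains representatives of all the values of x |-> dim H(x). *)
Definition measurable_collection (H : X -> hilbertType R k) : Prop :=
  (exists2 C : set X, countable C &
     forall x, exists2 y, C y & same_dim (H x) (H y)) /\
  (forall y, measurable [set x | same_dim (H x) (H y)]).

(* The values of x |-> dim H(x), which are at most countably many, are numbered
   by [dim_index]; [model i] is the fixed space with which H(x) is identified
   for all x with [dim_index x = i], and [ident i x] is the identification.
   The map [ident i x] is irrelevant when [dim_index x <> i]. *)
Record identification (H : X -> hilbertType R k) := Identification {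
  dim_index : X -> nat;
  dim_indexP : forall x y, dim_index x = dim_index y <-> same_dim (H x) (H y);
  model : nat -> hilbertType R k;
  ident : forall (i : nat) (x : X), {linear H x -> model i};
  identP : forall i x, dim_index x = i -> unitary (ident i x)
}.

Definition simple_on (V : hilbertType R k) (D : set X) (g : X -> V) : Prop :=
  finite_set (g @` D) /\ forall v, measurable (D `&` g @^-1` [set v]).

Definition strongly_measurable (V : hilbertType R k) (D : set X) (f : X -> V)
    : Prop :=
  exists2 g : nat -> X -> V, (forall n, simple_on D (g n)) &
    {ae mu, forall x, D x -> g n x @[n --> \oo] --> f x}.

(* Elements of the direct integral are handled through representatives. *)
Definition direct_integral (H : X -> hilbertType R k) (I : identification H)
    : set (forall x, H x) :=
  [set f |
    (forall i, strongly_measurable (dim_index I @^-1` [set i])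
                 (fun x => ident I i x (f x))) /\
    (\int[mu]_x ((hnorm (f x)) ^+ 2)%:E < +oo)%E].

Definition direct_inner (H : X -> hilbertType R k) (f g : forall x, H x)
    : sfield R k :=
  scalar_integral mu (fun x => inner (H x) (f x) (g x)).

(* Sequences are indexed from 0: index n stands for n + 1 in the usual
   numbering by positive integers. *)
Definition orthonormal_system (H : X -> hilbertType R k)
    (I : identification H) (phi : nat -> forall x, H x) : Prop :=
  (forall n, direct_integral I (phi n)) /\
  (forall m n, direct_inner (phi m) (phi n) = (m == n)%:R).

Definition partial_sum (H : X -> hilbertType R k) (phi : nat -> forall x, H x)
    (a : nat -> sfield R k) (m : nat) (x : X) : H x :=
  \sum_(n < m.+1) a n *: phi n x.

Definition majorant (H : X -> hilbertType R k) (phi : nat -> forall x, H x)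
    (a : nat -> sfield R k) (x : X) : \bar R :=
  ereal_sup [set (hnorm (partial_sum phi a m x))%:E | m in [set: nat]].

(* Measurability with respect to the completion of [mu]. *)
Definition ae_measurable (f : X -> \bar R) : Prop :=
  exists2 g : X -> \bar R, measurable_fun setT g & f = g %[ae mu].

End DirectIntegral.

Definition log2 (R : realType) (t : R) : R := ln t / ln 2.

(* The sum of |a_n|^2 log_2^2(n + 1) over n >= 1, with the index shift. *)
Definition log_sum (R : realType) (k : scalar_kind) (a : nat -> sfield R k)
    : \bar R :=
  (\sum_(0 <= n <oo) ((sre `|a n|) ^+ 2 * (log2 (n.+2)%:R) ^+ 2)%:E)%E.

(* Main.v *)
Require Import Defs.
From mathcomp Require Import all_boot all_order all_algebra.
From mathcomp Require Import all_classical all_reals all_analysis.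
From mathcomp Require Import measurable_realfun.
From mathcomp Require Import complex ring lra.
Import Order.TTheory GRing.Theory Num.Theory.
Import numFieldNormedType.Exports.
Local Open Scope classical_set_scope.
Local Open Scope ring_scope.
Set Implicit Arguments.
Unset Strict Implicit.
Unset Printing Implicit Defensive.

(* Split the indices into the blocks B_j = {n : 2^j <= n < 2^(j+1)}, put
   w_j = max(j, 1), so that w_j <= log_2(n+1) for n in B_j, and let b_j(x) be
   the sum of a_n phi_n(x) over B_j. A partial sum ending in B_j is
   b_0 + ... + b_(j-1) plus a prefix of B_j. By Cauchy-Schwarz
   |b_0 + ... + b_(j-1)|^2 <= (sum 1/w_i^2) (sum w_i^2 |b_i|^2), where
   sum 1/w_i^2 <= 3; and every prefix of B_j is a union of at most j+1 dyadic
   intervals, one of each length, so its squared norm is at most (j+1) Q_j, with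
   Q_j the sum of the squared norms over all dyadic subintervals of B_j. Hence
   |S_m|^2 <= F := sum_j (6 w_j^2 |b_j|^2 + 2 (j+1) Q_j) for all m, and the
   tails of this series control S_m - S_l. By orthonormality the integral of F
   is the sum over j of (6 w_j^2 + 2 (j+1)^2) |a|^2(B_j), at most 14 L since
   j+1 <= 2 w_j; and 14 <= 4^2. Where F is finite, S_m is Cauchy. *)

(** * Real and imaginary parts, uniformly for real and complex scalars *)

Section Scalars.
Variables (R : realType) (k : scalar_kind).
Implicit Types x y : sfield R k.

Definition sim : sfield R k -> R :=
  match k return sfield R k -> R with
  | RealScalars => fun=> 0
  | ComplexScalars => fun z : R[i] => complex.Im z
  end.

Definition semb : R -> sfield R k :=
  match k return R -> sfield R k with
  | RealScalars => fun r => r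
  | ComplexScalars => fun r => (r%:C)%C
  end.

(** The imaginary unit, with default value 0 for real scalars, where [sim] vanishes as well; thus
    [simE] covers both kinds. *)
Definition sunit : sfield R k :=
  match k return sfield R k with
  | RealScalars => 0
  | ComplexScalars => ('i)%C
  end.

Lemma sreD x y : sre (x + y) = sre x + sre y.
Proof. by rewrite /sre; case: k x y => //= -[a b] [c d]. Qed.

Lemma sreN x : sre (- x) = - sre x.
Proof. by rewrite /sre; case: k x => //= -[a b]. Qed.

Lemma sre0 : sre (0 : sfield R k) = 0.
Proof. by rewrite /sre; case: k. Qed.

Lemma sre_sum (T : Type) (r : seq T) (P : pred T) (F : T -> sfield R k) :
  sre (\sum_(i <- r | P i) F i) = \sum_(i <- r | P i) sre (F i).
Proof. exact: (big_morph _ sreD sre0). Qed.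

Lemma sreM x y : sre (x * y) = sre x * sre y - sim x * sim y.
Proof.
by rewrite /sre /sim; case: k x y => /= [x y|[a b] [c d]//]; rewrite mul0r subr0.
Qed.

Lemma simE x : sim x = - sre (sunit * x).
Proof.
rewrite /sim /sre /sunit; case: k x => /= [x|[a b]] /=.
  by rewrite mul0r oppr0.
by ring.
Qed.

Lemma sre_conj x : sre (sconj x) = sre x.
Proof. by rewrite /sre /sconj; case: k x => //= -[]. Qed.

Lemma sre_semb r : sre (semb r) = r.
Proof. by rewrite /sre /semb; case: k. Qed.

Lemma semb_sre x : 0 <= x -> semb (sre x) = x.
Proof.
rewrite /sre /semb; case: k x => //= -[a b]; rewrite lecE /= => /andP[/eqP-> _].
by [].
Qed.

Lemma sim_ge0 x : 0 <= x -> sim x = 0.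
Proof. by rewrite /sim; case: k x => //= -[a b]; rewrite lecE /= => /andP[/eqP]. Qed.

Lemma semb_lt r s : (semb r < semb s) = (r < s).
Proof. by rewrite /semb; case: k => //=; rewrite ltcR. Qed.

Lemma semb0 : semb 0 = 0.
Proof. by rewrite /semb; case: k. Qed.

Lemma ler_sre x y : x <= y -> sre x <= sre y.
Proof.
by rewrite /sre; case: k x y => //= -[a b] [c d]; rewrite lecE /= => /andP[].
Qed.

Lemma ltr_sre x y : x < y -> sre x < sre y.
Proof.
by rewrite /sre; case: k x y => //= -[a b] [c d]; rewrite ltcE /= => /andP[].
Qed.

Lemma sre_ge0 x : 0 <= x -> 0 <= sre x.
Proof. by move=> /ler_sre; rewrite sre0. Qed.

Lemma sreM_ge0 x y : 0 <= x -> sre (x * y) = sre x * sre y.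
Proof. by move=> x0; rewrite sreM (sim_ge0 x0) mul0r subr0. Qed.

Lemma sre_nat n : sre (n%:R : sfield R k) = n%:R.
Proof.
have sre1 : sre (1 : sfield R k) = 1 by rewrite /sre; case: k.
by elim: n => [|n IHn]; rewrite ?sre0// !mulrS sreD sre1 IHn.
Qed.

Lemma sim_nat n : sim (n%:R : sfield R k) = 0.
Proof. by rewrite sim_ge0. Qed.

Lemma sre_normr2 x : sre (x * sconj x) = (sre `|x|) ^+ 2.
Proof.
rewrite /sre /sconj; case: k x => /= [x|x].
  by rewrite real_normK ?num_real.
rewrite -normCK; case: x => a b.
by rewrite normc_def expr2 /= mulr0 subr0.
Qed.

End Scalars.
Arguments sunit {R k}.

(** * Norm and inner product in a Hilbert space, with real values *)

Section Hilbert.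
Variables (R : realType) (k : scalar_kind).
Implicit Types H : hilbertType R k.

Lemma hnorm_ge0 H (v : H) : 0 <= hnorm v.
Proof. exact: sre_ge0. Qed.

Lemma hnorm0 H : hnorm (0 : H) = 0.
Proof. by rewrite /hnorm normr0 sre0. Qed.

Lemma hnormN H (v : H) : hnorm (- v) = hnorm v.
Proof. by rewrite /hnorm normrN. Qed.

Lemma ler_hnormD H (u v : H) : hnorm (u + v) <= hnorm u + hnorm v.
Proof. by rewrite /hnorm -sreD; apply: ler_sre; exact: ler_normD. Qed.

Lemma ler_hnormB H (u v : H) : `|hnorm u - hnorm v| <= hnorm (u - v).
Proof.
rewrite ler_norml; apply/andP; split.
  have := ler_hnormD (v - u) u; rewrite subrK -(hnormN (u - v)) opprB.
  by move=> h; lra.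
by have := ler_hnormD (u - v) v; rewrite subrK => h; lra.
Qed.

Lemma hnorm2E H (v : H) : sre (inner H v v) = hnorm v ^+ 2.
Proof. by rewrite inner_normE expr2 sreM_ge0. Qed.

Lemma innerDl H (u v w : H) : inner H (u + v) w = inner H u w + inner H v w.
Proof. exact: linearDl. Qed.

Lemma innerDr H (u v w : H) : inner H u (v + w) = inner H u v + inner H u w.
Proof. exact: linearDr. Qed.

Lemma innerZl H (c : sfield R k) (u v : H) : inner H (c *: u) v = c * inner H u v.
Proof. exact: linearZl_LR. Qed.

Lemma innerZr H (c : sfield R k) (u v : H) :
  inner H u (c *: v) = sconj c * inner H u v.
Proof. exact: linearZr_LR. Qed.

Lemma inner_conj H (u v : H) : inner H u v = sconj (inner H v u).
Proof. by have := @hermitian_subproof _ _ _ _ (inner H) u v; rewrite expr0 mul1r. Qed.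

Lemma hnormD_sqr H (u v : H) :
  hnorm (u + v) ^+ 2 = hnorm u ^+ 2 + hnorm v ^+ 2 + 2 * sre (inner H u v).
Proof.
rewrite -!hnorm2E innerDl !innerDr !sreD (inner_conj v u) sre_conj; ring.
Qed.

(** Polarization: measurability of inner products is thereby reduced to that of norms of linear
    combinations. *)
Lemma sre_innerE H (u v : H) :
  sre (inner H u v) = (hnorm (u + v) ^+ 2 - hnorm (u - v) ^+ 2) / 4.
Proof.
rewrite !hnormD_sqr hnormN.
have -> : inner H u (- v) = - inner H u v by exact: linearNr.
by rewrite sreN; lra.
Qed.

(** Turns every question about imaginary parts into one about real parts. *)
Lemma sim_innerE H (u v : H) :
  sim (inner H u v) = - sre (inner H (sunit *: u) v).
Proof. by rewrite simE innerZl. Qed.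

Lemma normr_sre_inner_le H (u v : H) :
  `|sre (inner H u v)| <= (hnorm u ^+ 2 + hnorm v ^+ 2) / 2.
Proof.
rewrite ler_norml; apply/andP; split.
  by have := hnormD_sqr u v; have := sqr_ge0 (hnorm (u + v)); lra.
have := hnormD_sqr u (- v); rewrite hnormN.
have -> : inner H u (- v) = - inner H u v by exact: linearNr.
by rewrite sreN; have := sqr_ge0 (hnorm (u - v)); lra.
Qed.

(** Only an inequality, because [sunit] is 0 for real scalars. *)
Lemma hnorm_sunit_le H (u : H) : hnorm (sunit *: u) <= hnorm u.
Proof.
have s1 : sre `|@sunit R k| <= 1.
  rewrite /sunit /sre; case: k => /=; first by rewrite normr0.
  by rewrite expr0n expr1n add0r sqrtr1.
by rewrite /hnorm normrZ sreM_ge0// ler_piMl// sre_ge0.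
Qed.

(** The expansion is split into real and imaginary parts so that it can be integrated term by term
    with real integrals. *)
Lemma hnorm_sum_sqr H (c : nat -> sfield R k) (u : nat -> H) (r : seq nat) :
  hnorm (\sum_(n <- r) c n *: u n) ^+ 2 =
  \sum_(m <- r) \sum_(n <- r)
    (sre (c m * sconj (c n)) * sre (inner H (u m) (u n)) -
     sim (c m * sconj (c n)) * sim (inner H (u m) (u n))).
Proof.
rewrite -hnorm2E.
have -> : inner H (\sum_(n <- r) c n *: u n) (\sum_(n <- r) c n *: u n) =
    \sum_(m <- r) \sum_(n <- r) (c m * sconj (c n)) * inner H (u m) (u n).
  rewrite linear_sumlz; apply: eq_bigr => m _; rewrite linear_sumr.
  by apply: eq_bigr => n _; rewrite /= innerZl innerZr mulrA.
rewrite sre_sum; apply: eq_bigr => m _; rewrite sre_sum.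
by apply: eq_bigr => n _; rewrite sreM.
Qed.

Lemma cvg_hnorm H (u : nat -> H) (v : H) :
  u @ \oo --> v -> hnorm (u n) @[n --> \oo] --> hnorm v.
Proof.
move=> uv; apply/cvgrPdist_lt => e e0.
have se0 : 0 < semb k e by rewrite -(semb0 R k) semb_lt.
move/cvgrPdist_lt : uv => /(_ _ se0); apply: filterS => n.
move=> /ltr_sre; rewrite sre_semb; apply: le_lt_trans.
exact: ler_hnormB.
Qed.

(** Completeness, with the Cauchy condition in the form where the centre [v] may depend on [e];
    later [v] is a partial sum ending at a block boundary. *)
Lemma hnorm_cauchy_cvg H (u : nat -> H) :
  (forall e : R, 0 < e -> exists N, exists v,
    forall n, (N <= n)%N -> hnorm (v - u n) < e) -> cvgn u.
Proof.
move=> uC; apply/cauchy_cvgP/cauchy_exP => e e0.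
have [|N [v vN]] := uC (sre e); first by rewrite -(sre0 R k) ltr_sre.
exists v; exists N => // n /= Nn; rewrite -ball_normE /=.
by rewrite -(semb_sre (normr_ge0 _)) -(semb_sre (ltW e0)) semb_lt; exact: vN.
Qed.

Lemma unitary_hnorm H1 H2 (U : {linear H1 -> H2}) (v : H1) :
  unitary U -> hnorm (U v) = hnorm v.
Proof.
move=> [_ Uin]; apply/eqP; rewrite -(eqrXn2 (n := 2))// ?hnorm_ge0//.
by rewrite -!hnorm2E Uin.
Qed.

End Hilbert.

(** * Dyadic blocks and pointwise bounds for partial sums *)

Section Dyadic.
Variable R : realType.
Implicit Types f : nat -> nat -> R.

Definition weight (j : nat) : R := (maxn j 1)%:R.

(* The blocks [dyad k, dyad k.+1[ correspond to 2^k <= n < 2^(k+1) in the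
   numbering from 1. *)
Definition dyad (j : nat) : nat := (2 ^ j).-1.

(** The sum of [f] over the binary tree of dyadic subintervals of [[p, p + 2 ^ j[]; on squared norms
    it is the quantity Q_j. *)
Fixpoint dyadic_sum f (j p : nat) : R :=
  match j with
  | 0 => f p p.+1
  | i.+1 => f p (p + 2 ^ j)%N + (dyadic_sum f i p + dyadic_sum f i (p + 2 ^ i))
  end.

(** The j-th term of the series F. Both summands carry the 2 of [(y + z)^2 <= 2 y^2 + 2 z^2]; the 6
    also contains the bound 3 of the sum of the inverse squared weights. *)
Definition block_bound f (j : nat) : R :=
  6 * (weight j ^+ 2 * f (dyad j) (dyad j.+1)) +
  2 * (j.+1%:R * dyadic_sum f j (dyad j)).

Lemma weight_gt0 j : 0 < weight j.
Proof. by rewrite ltr0n leq_max orbT. Qed.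

Lemma weight0 : weight 0 = 1. Proof. by []. Qed.

Lemma weightS j : weight j.+1 = j.+1%:R.
Proof. by rewrite /weight; congr _%:R; exact/maxn_idPl. Qed.

Lemma dyadS j : dyad j.+1 = (dyad j + 2 ^ j)%N.
Proof. by rewrite /dyad expnS mul2n -addnn; have := expn_gt0 2 j; case: (2 ^ j)%N. Qed.

Lemma leq_dyad i j : (i <= j)%N -> (dyad i <= dyad j)%N.
Proof.
move/subnKC <-; elim: (j - i)%N => [|n IHn]; first by rewrite addn0.
by rewrite addnS dyadS (leq_trans IHn)// leq_addr.
Qed.

Lemma ltn_dyad j : (j <= dyad j)%N.
Proof. by rewrite /dyad -ltnS prednK ?expn_gt0// ltn_expl. Qed.

(** Take the largest [j] with [dyad j <= n]; it exists because [j <= dyad j]. *)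
Lemma dyad_bracket i n : (dyad i <= n)%N ->
  exists j, [/\ (i <= j)%N, (dyad j <= n)%N & (n <= dyad j.+1)%N].
Proof.
move=> in_; have ub j : (dyad j <= n)%N -> (j <= n)%N.
  exact/leq_trans/ltn_dyad.
have ex : exists j, (dyad j <= n)%N by exists i.
case: (ex_maxnP ex ub) => j jn jmax; exists j; split=> //; first exact: jmax.
by rewrite leqNgt; apply/negP => /ltnW /jmax; rewrite ltnn.
Qed.

Lemma dyadic_sum_ge0 f j p : (forall p q, 0 <= f p q) -> 0 <= dyadic_sum f j p.
Proof. by move=> f0; elim: j p => [|j IHj] p //=; rewrite !addr_ge0. Qed.

Lemma dyadic_sum_top f j p : (forall p q, 0 <= f p q) ->
  f p (p + 2 ^ j)%N <= dyadic_sum f j p.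
Proof.
move=> f0; case: j => [|j] /=; first by rewrite expn0 addn1.
by rewrite lerDl addr_ge0// dyadic_sum_ge0.
Qed.

Lemma block_bound_ge0 f j : (forall p q, 0 <= f p q) -> 0 <= block_bound f j.
Proof.
by move=> f0; rewrite addr_ge0 ?(sqr_ge0, mulr_ge0) ?dyadic_sum_ge0.
Qed.

(** Weighted Cauchy-Schwarz, by induction on the list; only the cross term [2 * (b j * S)] needs an
    argument. *)
Lemma sqr_sum_le (b : nat -> R) (r : seq nat) :
  (\sum_(j <- r) b j) ^+ 2 <=
  (\sum_(j <- r) (weight j ^+ 2)^-1) * \sum_(j <- r) weight j ^+ 2 * b j ^+ 2.
Proof.
elim: r => [|j r IHr]; first by rewrite !big_nil expr0n mul0r.
rewrite !big_cons.
set S := \sum_(_ <- _) _ in IHr *; set C := \sum_(_ <- _) _ in IHr *.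
set G := \sum_(_ <- _) _ in IHr *.
have C0 : 0 <= C by apply: sumr_ge0 => i _; rewrite invr_ge0 sqr_ge0.
have G0 : 0 <= G by apply: sumr_ge0 => i _; rewrite ?(sqr_ge0, mulr_ge0).
have w0 := weight_gt0 j.
set v := (weight j ^+ 2)^-1; have v0 : 0 < v by rewrite invr_gt0 exprn_gt0.
have -> : weight j ^+ 2 = v^-1 by rewrite invrK.
have cross : 2 * (b j * S) <= v * G + C * (v^-1 * b j ^+ 2).
  have vi0 : 0 <= v^-1 by rewrite invr_ge0 ltW.
  have rhs0 : 0 <= v * G + C * (v^-1 * b j ^+ 2).
    by rewrite addr_ge0 ?(sqr_ge0, mulr_ge0)// ltW.
  (* For a positive left side both sides may be squared; then [S ^+ 2 <= C * G] and the inequality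
     [4 s t <= (s + t)^2] suffice. *)
  have [|lhs0] := leP (2 * (b j * S)) 0; first by move/le_trans; apply.
  rewrite -(ler_pXn2r (n := 2)) ?nnegrE ?(ltW lhs0)//.
  have -> : (2 * (b j * S)) ^+ 2 = 4 * b j ^+ 2 * S ^+ 2 by ring.
  apply: (@le_trans _ _ (4 * b j ^+ 2 * (C * G))).
    by rewrite ler_wpM2l// mulr_ge0 ?sqr_ge0.
  rewrite -subr_ge0.
  have -> : (v * G + C * (v^-1 * b j ^+ 2)) ^+ 2 - 4 * b j ^+ 2 * (C * G) =
    (v * G - C * (v^-1 * b j ^+ 2)) ^+ 2 by field; rewrite gt_eqF.
  exact: sqr_ge0.
have -> : (v + C) * (v^-1 * b j ^+ 2 + G) =
    b j ^+ 2 + C * G + (v * G + C * (v^-1 * b j ^+ 2)) by field; rewrite gt_eqF.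
have -> : (b j + S) ^+ 2 = b j ^+ 2 + S ^+ 2 + 2 * (b j * S) by ring.
by rewrite lerD// lerD2l.
Qed.

Lemma sum_weightV_le (i j : nat) : \sum_(i <= l < j) (weight l ^+ 2)^-1 <= 3.
Proof.
have wV0 l : 0 <= (weight l ^+ 2)^-1 by rewrite invr_ge0 sqr_ge0.
apply: (@le_trans _ _ (\sum_(0 <= l < j) (weight l ^+ 2)^-1)).
  have [ij|ji] := leqP i j; last by rewrite big_geq ?(ltnW ji)// sumr_ge0.
  by rewrite (big_cat_nat (leq0n i) ij) /= lerDr sumr_ge0.
case: j => [|[|j]]; first by rewrite big_geq.
  by rewrite big_nat1 weight0 expr1n invr1; lra.
(* The sharper bound is inductive: it starts as the equality 1 + 1 = 3 - 1 and continues by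
   [1 / (1 + x)^2 <= 1 / x - 1 / (1 + x)]. *)
apply: (@le_trans _ _ (3 - (weight j.+1)^-1)).
  elim: j => [|j IHj].
    by rewrite big_nat_recr//= big_nat1 weight0 weightS !(expr1n, invr1); lra.
  rewrite big_nat_recr//=; apply: (le_trans (lerD IHj (lexx _))).
  rewrite !weightS.
  have j0 : 0 < j.+1%:R :> R by rewrite ltr0n.
  rewrite -[j.+2%:R]nat1r; move: (j.+1%:R : R) j0 => x x0.
  rewrite -addrA lerD2l -lerBrDl -subr_ge0.
  have -> : - (1 + x)^-1 - - x^-1 - ((1 + x) ^+ 2)^-1 = (x * (1 + x) ^+ 2)^-1.
    by field; rewrite !gt_eqF// addr_gt0.
  by rewrite invr_ge0 mulr_ge0 ?sqr_ge0// ltW.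
by rewrite gerBl invr_ge0 ltW ?weight_gt0.
Qed.

(** * Series of vectors in one Hilbert space *)

Section Series.
Variables (k : scalar_kind) (H : hilbertType R k) (u : nat -> H).

Let sqn (p q : nat) : R := hnorm (\sum_(p <= n < q) u n) ^+ 2.

Let sqn_ge0 p q : 0 <= sqn p q. Proof. exact: sqr_ge0. Qed.

(** Induction by halving: a prefix either lies in the first half of the interval, or is that half
    followed by a prefix of the second half. *)
Lemma prefix_sqr_le j p q : (q <= 2 ^ j)%N ->
  sqn p (p + q) <= j.+1%:R * dyadic_sum sqn j p.
Proof.
elim: j p q => [|j IHj] p q qj.
  rewrite mul1r; case: q qj => [_|[_|//]] /=; last by rewrite addn1.
  by rewrite addn0 {1}/sqn big_geq// hnorm0 expr0n sqn_ge0.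
have D0 i r : 0 <= dyadic_sum sqn i r by exact: dyadic_sum_ge0.
have [qj'|jq] := leqP q (2 ^ j).
  apply: (le_trans (IHj p q qj')); apply: ler_pM => //.
    by rewrite ler_nat.
  by rewrite /= [leRHS]addrCA lerDl addr_ge0.
have qE : (p + q)%N = (p + 2 ^ j + (q - 2 ^ j))%N by rewrite -addnA subnKC// ltnW.
have := IHj (p + 2 ^ j)%N (q - 2 ^ j)%N.
rewrite -qE leq_subLR addnn -mul2n -expnS qj => /(_ isT) hy.
have hx := dyadic_sum_top j p sqn_ge0.
(* The term of the whole interval is dropped from [dyadic_sum]; the two halves suffice. *)
apply: (@le_trans _ _
    (j.+2%:R * (dyadic_sum sqn j p + dyadic_sum sqn j (p + 2 ^ j)))); last first.
  by rewrite ler_wpM2l//= lerDr.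
have split_pq : \sum_(p <= n < p + q) u n =
    \sum_(p <= n < p + 2 ^ j) u n + \sum_(p + 2 ^ j <= n < p + q) u n.
  by rewrite -(big_cat_nat (n := (p + 2 ^ j)%N)) ?leq_addr// leq_add2l ltnW.
have tri : hnorm (\sum_(p <= n < p + q) u n) <=
    hnorm (\sum_(p <= n < p + 2 ^ j) u n) +
    hnorm (\sum_(p + 2 ^ j <= n < p + q) u n).
  by rewrite split_pq ler_hnormD.
move: tri hx hy; rewrite /sqn.
set x := hnorm (\sum_(p <= n < p + 2 ^ j) _).
set y := hnorm (\sum_(p + 2 ^ j <= n < p + q) _).
set A := dyadic_sum _ _ _; set B := dyadic_sum _ _ _.
have x0 : 0 <= x by exact: hnorm_ge0.
have y0 : 0 <= y by exact: hnorm_ge0.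
move=> tri hx hy.
apply: (@le_trans _ _ ((x + y) ^+ 2)).
  by rewrite ler_pXn2r// nnegrE ?addr_ge0 ?hnorm_ge0.
rewrite -[j.+2%:R]nat1r; move: (j.+1%:R : R) (ltr0Sn R j) hy => c c0 hy.
(* (x + y)^2 <= (1 + c) (x^2 + y^2 / c) *)
have hy' : y ^+ 2 / c <= B by rewrite ler_pdivrMr// mulrC.
apply: (@le_trans _ _ ((1 + c) * (x ^+ 2 + y ^+ 2 / c))); last first.
  by rewrite ler_wpM2l ?addr_ge0 ?(ltW c0)// lerD.
rewrite -subr_ge0.
have -> : (1 + c) * (x ^+ 2 + y ^+ 2 / c) - (x + y) ^+ 2 = (c * x - y) ^+ 2 / c.
  by field; rewrite gt_eqF.
by rewrite divr_ge0 ?sqr_ge0 ?ltW.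
Qed.

Lemma dyadic_blocks_sqr_le i j : (i <= j)%N ->
  sqn (dyad i) (dyad j) <=
  3 * \sum_(i <= l < j) weight l ^+ 2 * sqn (dyad l) (dyad l.+1).
Proof.
move=> ij.
have tri : hnorm (\sum_(dyad i <= n < dyad j) u n) <=
    \sum_(i <= l < j) hnorm (\sum_(dyad l <= n < dyad l.+1) u n).
  move/subnKC : ij => <-; elim: (j - i)%N => [|n IHn].
    by rewrite addn0 !big_geq// hnorm0.
  rewrite addnS big_nat_recr ?leq_addr//=.
  rewrite (big_cat_nat (n := dyad (i + n))) ?leq_dyad ?leq_addr//=.
  exact/(le_trans (ler_hnormD _ _))/lerD.
apply: (@le_trans _ _
    ((\sum_(i <= l < j) hnorm (\sum_(dyad l <= n < dyad l.+1) u n)) ^+ 2)).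
  by rewrite ler_pXn2r ?nnegrE ?sumr_ge0 ?hnorm_ge0// => l _; exact: hnorm_ge0.
apply: (le_trans (sqr_sum_le _ _)); apply: ler_wpM2r (sum_weightV_le _ _).
by apply: sumr_ge0 => l _; rewrite ?(sqr_ge0, mulr_ge0).
Qed.

(** The start [i] is free: [i = 0] bounds whole partial sums, large [i] controls the tails. *)
Lemma sqr_le_block_bound i n : (dyad i <= n)%N ->
  exists j, sqn (dyad i) n <= \sum_(i <= l < j) block_bound sqn l.
Proof.
move=> in_; have [j [ij jn nj]] := dyad_bracket in_.
exists j.+1; rewrite big_nat_recr//=.
have h1 := dyadic_blocks_sqr_le ij.
have h2 : sqn (dyad j) n <= j.+1%:R * dyadic_sum sqn j (dyad j).
  by rewrite -(subnKC jn); apply: prefix_sqr_le; rewrite leq_subLR -dyadS.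
have tri : hnorm (\sum_(dyad i <= l < n) u l) <=
    hnorm (\sum_(dyad i <= l < dyad j) u l) + hnorm (\sum_(dyad j <= l < n) u l).
  by rewrite (big_cat_nat (n := dyad j)) ?leq_dyad//= ler_hnormD.
have h3 : sqn (dyad i) n <= 2 * sqn (dyad i) (dyad j) + 2 * sqn (dyad j) n.
  move: tri; rewrite /sqn.
  set x := hnorm (\sum_(dyad i <= l < n) _).
  set y := hnorm (\sum_(dyad i <= l < dyad j) _); set z := hnorm _ => tri.
  have x0 : 0 <= x by exact: hnorm_ge0.
  have y0 : 0 <= y by exact: hnorm_ge0.
  have z0 : 0 <= z by exact: hnorm_ge0.
  apply: (@le_trans _ _ ((y + z) ^+ 2)); first by rewrite ler_pXn2r ?nnegrE ?addr_ge0.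
  by rewrite -subr_ge0 (_ : _ - _ = (y - z) ^+ 2) ?sqr_ge0//; ring.
apply: (le_trans h3).
(* Each complete block uses only the first summand of its [block_bound], the last block [j] only the
   second. *)
apply: (@le_trans _ _ (\sum_(i <= l < j) 6 * (weight l ^+ 2 * sqn (dyad l) (dyad l.+1))
    + 2 * (j.+1%:R * dyadic_sum sqn j (dyad j)))).
  by rewrite -mulr_sumr lerD ?ler_pM2l// -[6]/(2 * 3)%:R natrM -mulrA ler_pM2l.
apply: lerD.
  apply: ler_sum => l _; rewrite lerDl.
  by rewrite !mulr_ge0 ?dyadic_sum_ge0.
by rewrite lerDr ?(sqr_ge0, mulr_ge0).
Qed.

Lemma sqr_le_block_series i n : (dyad i <= n)%N ->
  ((sqn (dyad i) n)%:E <= \sum_(i <= l <oo) (block_bound sqn l)%:E)%E.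
Proof.
move=> /sqr_le_block_bound[j hj].
have B0 l : (0 <= (block_bound sqn l)%:E)%E by rewrite lee_fin block_bound_ge0.
apply: (@le_trans _ _ (\sum_(i <= l < j) (block_bound sqn l)%:E)%E).
  by rewrite sumEFin lee_fin.
by apply: nneseries_lim_ge.
Qed.

Lemma cvg_block_series :
  (\sum_(0 <= l <oo) (block_bound sqn l)%:E < +oo)%E ->
  cvgn (fun m => \sum_(n < m.+1) u n).
Proof.
move=> Boo; apply: hnorm_cauchy_cvg => e e0.
have B0 l : true -> (0 <= (block_bound sqn l)%:E)%E.
  by rewrite lee_fin block_bound_ge0.
have e2 : (0 < (e ^+ 2)%:E)%E by rewrite lte_fin exprn_gt0.
have e2nbhs : nbhs (0 : \bar R)%E [set y | y < (e ^+ 2)%:E]%E.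
  exact: open_ereal_lt' e2.
have [i _ /(_ i (leqnn i))/= ie] := nneseries_tail_cvg Boo B0 e2nbhs.
(* The centre is the sum of the first [i] blocks; the partial sum with index [n] has [n.+1] terms,
   hence the shift below. *)
exists (dyad i), (\sum_(0 <= n < dyad i) u n) => n ni.
have ni' : (dyad i <= n.+1)%N by exact: leqW.
have := sqr_le_block_series ni'.
move=> /le_lt_trans/(_ ie); rewrite lte_fin ltr_pXn2r ?nnegrE ?hnorm_ge0 ?(ltW e0)//.
apply: le_lt_trans; rewrite -(big_mkord xpredT u).
rewrite (big_cat_nat (m := 0) (n := dyad i) (p := n.+1))//=.
by rewrite opprD addrA subrr add0r hnormN.
Qed.

End Series.
End Dyadic.

(** * Discarding a null set from an integral *)

Section NullSets.
Context (d : measure_display) (X : measurableType d) (R : realType).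
Variables (mu : {measure set X -> \bar R}) (N : set X).
Hypotheses (mN : measurable N) (N0 : mu N = 0%E).
Local Open Scope ereal_scope.
Import HBNNSimple.

(* The integral of a nonnegative function is a supremum over the simple
   functions below it, whether or not the function is measurable. *)
Lemma ge0_integral_setC_null (f : X -> \bar R) : (forall x, 0 <= f x) ->
  \int[mu]_x f x = \int[mu]_(x in ~` N) f x.
Proof.
move=> f0; have mNC : measurable (~` N) by exact: measurableC.
rewrite [RHS]integral_mkcond.
have fN0 x : 0 <= (f \_ (~` N)) x by exact: erestrict_ge0.
apply/eqP; rewrite eq_le; apply/andP; split.
  (* A simple function below [f], set to 0 on [N], keeps its integral and lies below the restriction
     of [f]. *)
  rewrite ge0_integralTE//; apply: ge_ereal_sup => _ [h /= hf <-].
  rewrite -integralT_nnsfun (@ge0_negligible_integral _ _ _ mu setT N)//; last 2 first.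
  - by apply/measurable_EFinP.
  - by move=> x _; rewrite lee_fin.
  rewrite setTD integral_nnsfun// (mrestrict h mNC) ge0_integralTE//.
  apply: ereal_sup_ubound; exists (proj_nnsfun h mNC) => //= x.
  by rewrite patchE mindicE; case: ifP; rewrite (mulr1, mulr0).
rewrite !ge0_integralTE//; apply: le_ereal_sup => _ [h /= hf <-].
exists h => //= x; apply: (le_trans (hf x)).
by rewrite patchE; case: ifP.
Qed.

(** Applied to parts of inner products, which are integrated over all of [X] while their
    measurability is established off [N]. *)
Lemma integral_setC_null (f : X -> \bar R) :
  \int[mu]_x f x = \int[mu]_(x in ~` N) f x.
Proof.
rewrite integralE [RHS]integralE.
by congr (_ - _); apply: ge0_integral_setC_null => x; rewrite ?funepos_ge0 ?funeneg_ge0.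
Qed.

End NullSets.

(** * Functions with finitely many values and measurable level sets *)

Section SimpleFunctions.
Context (d : measure_display) (X : measurableType d) (D : set X).

(** [simple_on] with an arbitrary codomain, so that the class is stable under composition with any
    map, in particular with [hnorm]. *)
Definition simple_fun (T : Type) (g : X -> T) : Prop :=
  finite_set (g @` D) /\ forall v, measurable (D `&` g @^-1` [set v]).

(** Every preimage is a finite union of level sets, whatever the set [Y]. *)
Lemma simple_fun_measurable (T : Type) (g : X -> T) (Y : set T) :
  simple_fun g -> measurable (D `&` g @^-1` Y).
Proof.
move=> [gfin gm].
have -> : D `&` g @^-1` Y = \bigcup_(v in g @` D `&` Y) (D `&` g @^-1` [set v]).
  apply/seteqP; split=> [x [Dx Yx]|x [_ [[y Dy <-] Yy] [Dx /= gx]]].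
    by exists (g x) => //; split=> //; exists x.
  by split=> //; rewrite /preimage /= gx.
by apply: fin_bigcup_measurable => [|v _]; [exact: finite_setIl | exact: gm].
Qed.

Lemma simple_fun_comp2 (A B C : Type) (op : A -> B -> C) (g : X -> A) (h : X -> B) :
  simple_fun g -> simple_fun h -> simple_fun (fun x => op (g x) (h x)).
Proof.
move=> gs hs; split; first by apply: finite_image11; [exact: gs.1 | exact: hs.1].
move=> v; pose Y a := [set b | op a b = v].
have -> : D `&` (fun x => op (g x) (h x)) @^-1` [set v] =
    \bigcup_(a in g @` D) ((D `&` g @^-1` [set a]) `&` (D `&` h @^-1` (Y a))).
  apply/seteqP; split=> [x [Dx /= vx]|x [_ [y Dy <-] [[Dx /= gx] [_]]]].
    by exists (g x); [exists x | split].
  by rewrite /Y /= -gx.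
apply: fin_bigcup_measurable => [|a _]; first exact: gs.1.
by apply: measurableI; [exact: gs.2 | exact: simple_fun_measurable].
Qed.

Lemma simple_fun_comp (A B : Type) (F : A -> B) (g : X -> A) :
  simple_fun g -> simple_fun (F \o g).
Proof. by move=> gs; exact: (simple_fun_comp2 (fun a _ => F a) gs gs). Qed.

Lemma simple_fun_cst (A : Type) (a : A) : measurable D -> simple_fun (cst a).
Proof.
move=> mD; split; first by apply: (sub_finite_set (B := [set a])) => // _ [x _ <-].
move=> v; rewrite preimage_cst; case: ifP => _; first by rewrite setIT.
by rewrite setI0.
Qed.

Lemma simple_fun_sum (R : pzRingType) (V : lmodType R) (I : Type) (c : I -> R)
    (g : I -> X -> V) (r : seq I) : measurable D ->
  (forall n, simple_fun (g n)) ->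
  simple_fun (fun x => \sum_(n <- r) c n *: g n x).
Proof.
move=> mD gs; elim: r => [|n r IHr].
  by under eq_fun do rewrite big_nil; exact: simple_fun_cst.
under eq_fun do rewrite big_cons.
apply: (simple_fun_comp2 +%R _ IHr).
exact: (simple_fun_comp (fun v => c n *: v)).
Qed.

End SimpleFunctions.

(** * Measurability of norms of linear combinations *)

Section StrongMeasurability.
Context (R : realType) (k : scalar_kind) (d : measure_display).
Context (X : measurableType d) (mu : {measure set X -> \bar R}).
Context (H : X -> hilbertType R k) (I : identification H).

(** One null set collects the exceptional points of all functions and all pieces. The list of
    coefficients and indices covers both blocks of the series and the combinations in the
    polarization formula. *)
Lemma measurable_hnorm_sum (phi : nat -> forall x, H x) :
  (forall n, direct_integral mu I (phi n)) ->
  exists N, [/\ measurable N, mu N = 0%E &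
    forall r : seq (sfield R k * nat),
      measurable_fun (~` N) (fun x => hnorm (\sum_(t <- r) t.1 *: phi t.2 x))].
Proof.
move=> phiP; pose D i := dim_index I @^-1` [set i].
have sm n i : {g : nat -> X -> model I i | (forall j, simple_on (D i) (g j)) &
    {ae mu, forall x, D i x -> g j x @[j --> \oo] --> ident I i x (phi n x)}}.
  exact/cid2/(phiP n).1.
pose g n i := s2val (sm n i).
have gs n i j : simple_fun (D i) (g n i j) by exact: (s2valP (sm n i)).
have gcvg n i : {ae mu, forall x, D i x ->
    g n i j x @[j --> \oo] --> ident I i x (phi n x)} by exact: (s2valP' (sm n i)).
(* A piece is the preimage of the full set under a simple function on it. *)
have mD i : measurable (D i).
  by have := simple_fun_measurable setT (gs 0 i 0); rewrite preimage_setT setIT.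
have : {ae mu, forall x, forall n i, D i x ->
    g n i j x @[j --> \oo] --> ident I i x (phi n x)}.
  by apply/ae_foralln => n; exact/ae_foralln.
case=> N [mN N0 Nsub]; exists N; split=> // r.
have xP x : ~ N x -> forall n i, D i x ->
    g n i j x @[j --> \oo] --> ident I i x (phi n x).
  by move=> Nx; apply: contrapT => h; exact/Nx/Nsub.
have -> : ~` N = \bigcup_i (D i `\` N).
  by apply/seteqP; split=> [x Nx|x [i _ []]//]; exists (dim_index I x).
apply/measurable_fun_bigcup => i; first exact: measurableD.
apply: (@measurable_fun_cvg _ _ _ _
    (fun j x => hnorm (\sum_(t <- r) t.1 *: g t.2 i j x))).
  move=> j; apply: (@measurable_funS _ _ _ _ (D i)) => //.
  move=> _ Y mY.
  have := simple_fun_sum fst r (mD i) (fun t => gs t.2 i j).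
  by move=> /(simple_fun_comp (@hnorm R k _))/simple_fun_measurable; apply.
(* The norm is computed in the fixed model space, where the simple approximations converge. *)
move=> x [Dx Nx]; rewrite -(unitary_hnorm _ (identP Dx)) linear_sum.
apply: cvg_hnorm; elim: r => [|t r IHr].
  by under eq_fun do rewrite big_nil; rewrite big_nil; exact: cvg_cst.
under eq_fun do rewrite big_cons; rewrite big_cons.
apply: cvgD IHr; rewrite linearZ; apply: cvgZr; exact: xP.
Qed.

End StrongMeasurability.

(** * Comparison of the block weights with the logarithms *)

Section Weights.
Variable R : realType.

(** Each of the [j.+1] levels of the tree partitions the interval, so it contributes the value on
    the whole interval. *)
Lemma dyadic_sum_additive (f : nat -> nat -> R) j p :
  (forall p q r, (p <= q)%N -> (q <= r)%N -> f p r = f p q + f q r) ->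
  dyadic_sum f j p = j.+1%:R * f p (p + 2 ^ j)%N.
Proof.
move=> fD; elim: j p => [|j IHj] p /=; first by rewrite addn1 mul1r.
rewrite !IHj -addnA addnn -mul2n -expnS -mulrDr -fD ?leq_add2l ?leq_addr//.
  by rewrite -[in RHS]nat1r mulrDl mul1r.
by rewrite leq_exp2l.
Qed.

(** The hypothesis says [2 ^ j <= n.+1]; for [j = 0], where the weight is 1, [2 <= n.+2] is used
    instead. *)
Lemma weight_le_log2 j n : (dyad j <= n)%N -> weight R j <= log2 n.+2%:R.
Proof.
move=> jn; have ln2 : 0 < ln 2 :> R by rewrite ln_gt0// ltr1n.
rewrite /log2 ler_pdivlMr// /weight mulr_natl -lnXn// ler_ln ?posrE ?exprn_gt0//.
rewrite -natrX ler_nat; case: (posnP j) => [->//|j0].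
rewrite (maxn_idPl j0) (@leq_trans n.+1)//.
by move: jn; rewrite /dyad -ltnS prednK ?expn_gt0.
Qed.

(** The constant is 14 = 6 + 2 * 4: one factor [j.+1] comes from [block_bound], another from the
    levels of the tree, and each is at most twice the weight. *)
Lemma block_bound_le_log (b : nat -> R) j : (forall n, 0 <= b n) ->
  block_bound (fun p q => \sum_(p <= n < q) b n) j <=
  14 * \sum_(dyad j <= n < dyad j.+1) b n * (log2 n.+2%:R) ^+ 2.
Proof.
move=> b0; rewrite /block_bound dyadic_sum_additive; last first.
  by move=> p q r pq qr; rewrite -big_cat_nat.
rewrite -dyadS; set A := \sum_(_ <= n < _) b n.
have A0 : 0 <= A by exact: sumr_ge0.
have w0 := weight_gt0 R j.
have wj : j.+1%:R <= 2 * weight R j.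
  case: j {A A0 w0} => [|j]; first by rewrite weight0 mulr1 ler_nat.
  by rewrite weightS -natrM ler_nat mul2n -addnn addnS !ltnS leq_addr.
apply: (@le_trans _ _ (14 * (weight R j ^+ 2 * A))).
  have -> : 14 * (weight R j ^+ 2 * A) =
      6 * (weight R j ^+ 2 * A) + 2 * ((2 * weight R j) * ((2 * weight R j) * A)).
    by ring.
  rewrite lerD2l ler_pM2l//; apply: ler_pM => //; first exact: mulr_ge0.
  exact: ler_wpM2r.
rewrite ler_pM2l// mulr_sumr.
rewrite [leLHS]big_nat_cond [leRHS]big_nat_cond; apply: ler_sum => n.
rewrite andbT => /andP[jn _].
have wl := weight_le_log2 jn.
rewrite mulrC ler_wpM2l// ler_pXn2r ?nnegrE//.
exact: le_trans (ltW w0) wl.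
Qed.

Lemma block_bound_series_le (b : nat -> R) : (forall n, 0 <= b n) ->
  (\sum_(0 <= j <oo) (block_bound (fun p q => \sum_(p <= n < q) b n) j)%:E <=
   14%:E * \sum_(0 <= n <oo) (b n * (log2 n.+2%:R) ^+ 2)%:E)%E.
Proof.
move=> b0; pose f p q := \sum_(p <= n < q) b n; rewrite -/f.
have f0 p q : 0 <= f p q by exact: sumr_ge0.
have bl0 n : 0 <= b n * (log2 n.+2%:R) ^+ 2 by rewrite mulr_ge0 ?sqr_ge0.
apply: lime_le; first by apply: is_cvg_nneseries => n _ _; rewrite lee_fin block_bound_ge0.
apply: nearW => J; rewrite sumEFin.
apply: (@le_trans _ _
    (14%:E * (\sum_(0 <= n < dyad J) (b n * (log2 n.+2%:R) ^+ 2)%:E))%E); last first.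
  apply: lee_wpmul2l; first by rewrite lee_fin.
  by apply: nneseries_lim_ge => n _ _; rewrite lee_fin.
rewrite sumEFin -EFinM lee_fin.
elim: J => [|J IHJ]; first by rewrite !big_geq// mulr0.
rewrite big_nat_recr//= (big_cat_nat (n := dyad J) (p := dyad J.+1)) ?leq_dyad//= mulrDr.
by apply: lerD => //; exact: block_bound_le_log.
Qed.

End Weights.

(** * Integrating the block bounds *)

Section BlockIntegrals.
Context (d : measure_display) (X : measurableType d) (R : realType).
Variables (mu : {measure set X -> \bar R}) (D : set X) (mD : measurable D).
Variables (e : X -> nat -> nat -> R) (A : nat -> nat -> R).
Hypothesis e0 : forall x p q, 0 <= e x p q.
Hypothesis me : forall p q, measurable_fun D (fun x => e x p q).
Hypothesis eA : forall p q, (\int[mu]_(x in D) (e x p q)%:E = (A p q)%:E)%E.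

Lemma measurable_dyadic_sum j p : measurable_fun D (fun x => dyadic_sum (e x) j p).
Proof.
elim: j p => [|j IHj] p /=; first exact: me.
by apply: measurable_funD; [exact: me|exact: measurable_funD].
Qed.

Lemma integral_dyadic_sum j p :
  (\int[mu]_(x in D) (dyadic_sum (e x) j p)%:E = (dyadic_sum A j p)%:E)%E.
Proof.
have D0 x i q : 0 <= dyadic_sum (e x) i q by exact: dyadic_sum_ge0.
have mds i q : measurable_fun D (fun x => (dyadic_sum (e x) i q)%:E).
  exact/measurable_EFinP/measurable_dyadic_sum.
elim: j p => [|j IHj] p /=; first exact: eA.
under eq_integral do rewrite 2!EFinD.
rewrite ge0_integralD//; last 4 first.
- by move=> x _; rewrite lee_fin.
- exact/measurable_EFinP.
- by move=> x _; rewrite -EFinD lee_fin addr_ge0.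
- exact: emeasurable_funD.
rewrite ge0_integralD//; last 2 first.
- by move=> x _; rewrite lee_fin.
- by move=> x _; rewrite lee_fin.
by rewrite eA !IHj !EFinD.
Qed.

Lemma measurable_block_bound j : measurable_fun D (fun x => block_bound (e x) j).
Proof.
apply: measurable_funD; apply: measurable_funM => //; apply: measurable_funM => //.
exact: measurable_dyadic_sum.
Qed.

(** [block_bound] is linear in its function argument with nonnegative coefficients, so it commutes
    with the integral. *)
Lemma integral_block_bound j :
  (\int[mu]_(x in D) (block_bound (e x) j)%:E = (block_bound A j)%:E)%E.
Proof.
have D0 x i q : 0 <= dyadic_sum (e x) i q by exact: dyadic_sum_ge0.
rewrite /block_bound; under eq_integral do rewrite EFinD !mulrA !(EFinM (_ * _)%R).
rewrite ge0_integralD//; last 4 first.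
- by move=> x _; rewrite -EFinM lee_fin !(sqr_ge0, mulr_ge0).
- exact/measurable_funeM/measurable_EFinP.
- by move=> x _; rewrite -EFinM lee_fin !mulr_ge0.
- exact/measurable_funeM/measurable_EFinP/measurable_dyadic_sum.
rewrite ge0_integralZl_EFin//; last 3 first.
- by move=> x _; rewrite lee_fin.
- exact/measurable_EFinP.
- by rewrite !(sqr_ge0, mulr_ge0).
rewrite ge0_integralZl_EFin//; last 2 first.
- by move=> x _; rewrite lee_fin.
- exact/measurable_EFinP/measurable_dyadic_sum.
by rewrite eA integral_dyadic_sum -!EFinM -EFinD expr2 !mulrA.
Qed.

End BlockIntegrals.

(** * Orthonormality, integration of the majorizing series, and conclusions *)

Section OrthonormalSystem.
Context (R : realType) (k : scalar_kind) (d : measure_display).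
Context (X : measurableType d) (mu : {measure set X -> \bar R}).
Context (H : X -> hilbertType R k).

Lemma sre_scalar_integral (h : X -> sfield R k) :
  sre (scalar_integral mu h) = \int[mu]_x sre (h x).
Proof. by rewrite /scalar_integral /sre; case: k h. Qed.

Lemma sim_scalar_integral (h : X -> sfield R k) :
  sim (scalar_integral mu h) = \int[mu]_x sim (h x).
Proof.
rewrite /scalar_integral /sim; case: k h => // h.
by rewrite /Rintegral integral0.
Qed.

Variables (phi : nat -> forall x, H x) (N : set X).
Hypotheses (mN : measurable N) (N0 : mu N = 0%E).
Hypothesis mphi : forall r : seq (sfield R k * nat),
  measurable_fun (~` N) (fun x => hnorm (\sum_(t <- r) t.1 *: phi t.2 x)).
Hypothesis phi2 : forall n, (\int[mu]_x ((hnorm (phi n x)) ^+ 2)%:E < +oo)%E.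
Hypothesis phi_orth : forall m n, direct_inner mu (phi m) (phi n) = (m == n)%:R.

Let mNC : measurable (~` N). Proof. exact: measurableC. Qed.

Lemma measurable_hnorm_block (a : nat -> sfield R k) p q :
  measurable_fun (~` N) (fun x => hnorm (\sum_(p <= n < q) a n *: phi n x)).
Proof.
have := mphi [seq (a n, n) | n <- index_iota p q].
by under eq_fun do rewrite big_map.
Qed.

Lemma measurable_sre_inner (c : sfield R k) m n :
  measurable_fun (~` N) (fun x => sre (inner (H x) (c *: phi m x) (phi n x))).
Proof.
under eq_fun do rewrite sre_innerE.
apply: measurable_funM => //; apply: measurable_funB; apply: measurable_funX.
  have := mphi [:: (c, m); (1, n)].
  by under eq_fun do rewrite big_cons big_seq1 /= scale1r.
have := mphi [:: (c, m); (-1, n)].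
by under eq_fun do rewrite big_cons big_seq1 /= scaleN1r.
Qed.

Lemma integrable_hnorm2 n :
  mu.-integrable (~` N) (fun x => (hnorm (phi n x) ^+ 2)%:E).
Proof.
apply/integrableP; split.
  apply/measurable_EFinP/measurable_funX.
  have := mphi [:: (1, n)].
  by under eq_fun do rewrite big_seq1 /= scale1r.
under eq_integral do rewrite gee0_abs ?lee_fin ?sqr_ge0//.
by rewrite -ge0_integral_setC_null// => x; rewrite lee_fin sqr_ge0.
Qed.

(** Dominated by the sum of the two squared norms. It is applied with [c = 1] for real parts and
    [c = sunit] for imaginary parts. *)
Lemma integrable_sre_inner (c : sfield R k) m n :
  (forall x, hnorm (c *: phi m x) <= hnorm (phi m x)) ->
  mu.-integrable (~` N) (fun x => (sre (inner (H x) (c *: phi m x) (phi n x)))%:E).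
Proof.
move=> hc.
apply: (le_integrable mNC _ _
  (integrableD mNC (integrable_hnorm2 m) (integrable_hnorm2 n))).
  exact/measurable_EFinP/measurable_sre_inner.
move=> x _ /=; rewrite lee_fin (ger0_norm (addr_ge0 _ _)) ?sqr_ge0//.
apply: (le_trans (normr_sre_inner_le _ _)).
have : hnorm (c *: phi m x) ^+ 2 <= hnorm (phi m x) ^+ 2.
  by rewrite ler_pXn2r ?nnegrE ?hnorm_ge0.
have := sqr_ge0 (hnorm (phi m x)); have := sqr_ge0 (hnorm (phi n x)).
by lra.
Qed.

Let G m n x := inner (H x) (phi m x) (phi n x).

Let integrable_sreG m n : mu.-integrable (~` N) (fun x => (sre (G m n x))%:E).
Proof.
have -> : (fun x => (sre (G m n x))%:E) =
    fun x => (sre (inner (H x) (1 *: phi m x) (phi n x)))%:E.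
  by apply/funext => x; rewrite scale1r.
by apply: integrable_sre_inner => x; rewrite scale1r.
Qed.

Let integrable_simG m n : mu.-integrable (~` N) (fun x => (sim (G m n x))%:E).
Proof.
rewrite /G; under eq_fun do rewrite sim_innerE EFinN.
by apply: integrableN => //; apply: integrable_sre_inner => x; exact: hnorm_sunit_le.
Qed.

Let integral_sreG m n :
  (\int[mu]_(x in ~` N) (sre (G m n x))%:E = (m == n)%:R%:E)%E.
Proof.
(* [Rintegral] sends infinite integrals to 0; integrability excludes this case, so the value is the
   one prescribed by orthonormality. *)
rewrite -[LHS]fineK ?integrable_fin_num// -integral_setC_null//.
rewrite -[fine _]/(\int[mu]_x sre (G m n x)) -sre_scalar_integral.
by rewrite -/(direct_inner mu (phi m) (phi n)) phi_orth sre_nat.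
Qed.

Let integral_simG m n : (\int[mu]_(x in ~` N) (sim (G m n x))%:E = 0)%E.
Proof.
rewrite -[LHS]fineK ?integrable_fin_num// -integral_setC_null//.
rewrite -[fine _]/(\int[mu]_x sim (G m n x)) -sim_scalar_integral.
by rewrite -/(direct_inner mu (phi m) (phi n)) phi_orth sim_nat.
Qed.

(** Pythagoras: after expanding the square, the off-diagonal terms and all imaginary parts integrate
    to 0. *)
Lemma integral_sqr_block (a : nat -> sfield R k) p q :
  (\int[mu]_(x in ~` N) (hnorm (\sum_(p <= n < q) a n *: phi n x) ^+ 2)%:E =
   (\sum_(p <= n < q) (sre `|a n|) ^+ 2)%:E)%E.
Proof.
pose T m n x : \bar R := ((sre (a m * sconj (a n)))%:E * (sre (G m n x))%:E -
  (sim (a m * sconj (a n)))%:E * (sim (G m n x))%:E)%E.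
have iT m n : mu.-integrable (~` N) (T m n).
  by apply: integrableB => //; exact: integrableZl.
have intT m n : (\int[mu]_(x in ~` N) T m n x =
    (sre (a m * sconj (a n)) * (m == n)%:R)%:E)%E.
  rewrite integralB//; [|exact: integrableZl|exact: integrableZl].
  by rewrite !integralZl// integral_sreG integral_simG mule0 sube0.
transitivity (\int[mu]_(x in ~` N)
    \sum_(m <- index_iota p q) \sum_(n <- index_iota p q) T m n x)%E.
  apply: eq_integral => x _; rewrite hnorm_sum_sqr -sumEFin.
  by apply: eq_bigr => m _; rewrite -sumEFin.
rewrite integral_sum//; last by move=> m; exact: integrable_sum.
rewrite -sumEFin; apply: eq_big_seq => m mr.
rewrite integral_sum// (bigD1_seq m)//= ?iota_uniq// intT eqxx mulr1 sre_normr2.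
rewrite big1 ?adde0// => n nm.
by rewrite intT eq_sym (negbTE nm) mulr0.
Qed.

Variables (a : nat -> sfield R k).

Let sqn x p q : R := hnorm (\sum_(p <= n < q) a n *: phi n x) ^+ 2.
Let A p q : R := \sum_(p <= n < q) (sre `|a n|) ^+ 2.
Let F x : \bar R := (\sum_(0 <= j <oo) (block_bound (sqn x) j)%:E)%E.

Let sqn_ge0 x p q : 0 <= sqn x p q. Proof. exact: sqr_ge0. Qed.

Let msqn p q : measurable_fun (~` N) (fun x => sqn x p q).
Proof. exact/measurable_funX/measurable_hnorm_block. Qed.

Let F_ge0 x : (0 <= F x)%E.
Proof. by apply: nneseries_ge0 => j _ _; rewrite lee_fin block_bound_ge0. Qed.

Let mF : measurable_fun (~` N) F.
Proof.
apply: ge0_emeasurable_sum => j => [x _ _|_]; first by rewrite lee_fin block_bound_ge0.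
exact/measurable_EFinP/measurable_block_bound.
Qed.

Let integral_F : (\int[mu]_(x in ~` N) F x <= 14%:E * log_sum a)%E.
Proof.
rewrite integral_nneseries//; last 2 first.
- by move=> j; exact/measurable_EFinP/measurable_block_bound.
- by move=> j x _; rewrite lee_fin block_bound_ge0.
(* After termwise integration, squared norms become the sums [A], which are additive over
   intervals. *)
rewrite (eq_eseriesr (g := fun j => (block_bound A j)%:E)); last first.
  move=> j _; apply: integral_block_bound => // p q.
  exact: integral_sqr_block.
by apply: block_bound_series_le => n; exact: sqr_ge0.
Qed.

(** [F] is integrable, hence finite almost everywhere, and finiteness at a point gives the Cauchy
    property there. *)
Lemma partial_sum_cvg_ae : (log_sum a < +oo)%E ->
  {ae mu, forall x, cvgn (fun m => partial_sum phi a m x)}.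
Proof.
move=> La; have iF : mu.-integrable (~` N) F.
  apply/integrableP; split => //.
  under eq_integral do rewrite gee0_abs//.
  apply: (le_lt_trans integral_F); apply: lte_mul_pinfty => //.
have : {ae mu, forall x, ~ N x} by exists N; split=> // x /= /contrapT.
apply: filterS2 (integrable_ae mNC iF) => x Ffin Nx.
have /andP[_ Foo] : (-oo < F x < +oo)%E by rewrite -fin_numElt; exact: Ffin.
exact: (@cvg_block_series _ _ _ (fun n => a n *: phi n x) Foo).
Qed.

Lemma measurable_majorant : measurable_fun (~` N) (majorant phi a).
Proof.
have -> : majorant phi a =
    fun x => esups (fun m => (hnorm (partial_sum phi a m x))%:E) 0.
  apply/funext => x; rewrite /majorant /esups /sdrop /=; congr ereal_sup.
  by apply/seteqP; split=> _ [m _ <-]; exists m.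
apply: measurable_fun_esups => m; apply/measurable_EFinP.
rewrite /partial_sum.
under eq_fun do rewrite -(big_mkord xpredT (fun n => a n *: phi n _)).
exact: measurable_hnorm_block.
Qed.

Lemma majorant_ge0 x : (0 <= majorant phi a x)%E.
Proof.
apply: (@le_trans _ _ (hnorm (partial_sum phi a 0 x))%:E).
  by rewrite lee_fin hnorm_ge0.
by apply: ereal_sup_ubound; exists 0%N.
Qed.

Lemma majorant_sqr_le x : (majorant phi a x `^ 2 <= F x)%E.
Proof.
have le2 (y z : \bar R) (r : R) :
      0 <= r -> (0 <= y -> y <= z -> y `^ r <= z `^ r)%E.
  move=> r0 y0 yz; apply: gt0_ler_poweR => //; rewrite in_itv /= leey andbT//.
  exact: le_trans yz.
(* The supremum is bounded before squaring, so each partial sum is compared with the root of [F];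
   [dyad 0] is 0, so the block series starts at the first term. *)
have sqrtF : (majorant phi a x <= F x `^ 2^-1)%E.
  apply: ge_ereal_sup => _ [m _ <-].
  have := @sqr_le_block_series _ _ _ (fun n => a n *: phi n x) 0 m.+1 isT.
  rewrite big_mkord -/(partial_sum phi a m x) => /(le2 _ _ 2^-1).
  rewrite lee_fin sqr_ge0 -powR_mulrn ?hnorm_ge0// poweR_EFin -powRrM mulfV//.
  rewrite powRr1 ?hnorm_ge0//.
  by apply.
apply: le_trans (le2 _ _ 2 (ler0n _ _) (majorant_ge0 x) sqrtF) _.
by rewrite -poweRrM mulVf// poweRe1.
Qed.

Lemma Lnorm_majorant_le : ('N[mu]_2%:E[majorant phi a] <= 4%:E * sqrte (log_sum a))%E.
Proof.
have L0 : (0 <= log_sum a)%E.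
  by apply: nneseries_ge0 => n _ _; rewrite lee_fin mulr_ge0 ?sqr_ge0.
(* With 4 moved under the root, it remains to compare integrals of squares, where 14 is enlarged to
   16. *)
have -> : (4%:E * sqrte (log_sum a) = (16%:E * log_sum a) `^ 2^-1)%E.
  rewrite poweR12_sqrt ?mule_ge0// sqrteM//=; congr (_%:E * _)%E.
  by rewrite (_ : 16 = 4 ^+ 2) ?sqrtr_sqr ?ger0_norm// -natrX.
rewrite unlock; apply: gt0_ler_poweR => //.
- by rewrite in_itv /= leey integral_ge0// => x _; exact: poweR_ge0.
- by rewrite in_itv /= leey mule_ge0.
rewrite (ge0_integral_setC_null mN N0); last by move=> x; exact: poweR_ge0.
apply: (@le_trans _ _ (\int[mu]_(x in ~` N) F x)%E).
  apply: ge0_le_integral => //.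
  - by move=> x _; exact: poweR_ge0.
  - have mabs : measurable_fun (~` N) (fun x => `|majorant phi a x|%E).
      exact/measurableT_comp/measurable_majorant.
    exact: (measurableT_comp (measurable_poweR 2) mabs).
  - by move=> x _; rewrite gee0_abs ?majorant_ge0// majorant_sqr_le.
apply: (le_trans integral_F); apply: lee_wpmul2r => //.
by rewrite lee_fin ler_nat.
Qed.

Lemma ae_measurable_majorant : ae_measurable mu (majorant phi a).
Proof.
(* The measurable representative is the majorant replaced by 0 on [N]. *)
exists (majorant phi a \_ (~` N)).
  exact/(measurable_restrictT _ mNC)/measurable_majorant.
exists N; split=> // x /= h; apply: contrapT => Nx; apply: h => _.
by rewrite patchE mem_set.
Qed.

End OrthonormalSystem.

Theorem theorem1 (R : realType) (k : scalar_kind)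
    (d : measure_display) (X : measurableType d)
    (mu : {measure set X -> \bar R})
    (H : X -> hilbertType R k) (hH : measurable_collection H)
    (I : identification H)
    (phi : nat -> forall x, H x) (hphi : orthonormal_system mu I phi)
    (a : nat -> sfield R k) (hL : (log_sum a < +oo)%E) :
  {ae mu, forall x, cvgn (fun m => partial_sum phi a m x)} /\
  ae_measurable mu (majorant phi a) /\
  ('N[mu]_2%:E[majorant phi a] <= 4%:E * sqrte (log_sum a))%E.
Proof.
have [phiL orth] := hphi.
have phi2 n : (\int[mu]_x ((hnorm (phi n x)) ^+ 2)%:E < +oo)%E.
  by have [] := phiL n.
(* The same null set serves all three conclusions. *)
have [N [mN N0 mphi]] := measurable_hnorm_sum phiL.
split; first exact: (partial_sum_cvg_ae mN N0 mphi phi2 orth hL).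
split; first exact: (ae_measurable_majorant mN N0 mphi).
exact: (Lnorm_majorant_le mN N0 mphi phi2 orth a).
Qed.
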